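(* Let $\mu$ be the Hawkins random sieve probability measure on the space $X$ of strictly increasing (finite or infinite) sequences of integers greater than $1$. Let $k\ge1$ be a fixed integer, and for $\alpha\in X$ and real $x$ let $\Pi_{X,X+k}(x;\alpha)=\#\{j\le x : j\in\alpha \text{ and } j+k\in\alpha\}$. Then for $\mu$-almost every $\alpha\in X$, $$\Pi_{X,X+k}(x;\alpha)\sim \frac{x}{(\log x)^2}\qquad (x\to\infty).$$
   Context: Hawkins random sieve (Wunderlich's formulation). Let $X$ be the set of all finite (including empty) and infinite strictly increasing sequences of integers greater than $1$, identified with subsets of $\{2,3,4,\ldots\}$. For $\alpha\in X$ and an integer $n\ge 2$ put $\alpha_n=\alpha\cap\{2,3,\ldots,n-1\}$. For integers $2\le a_1<\cdots<a_r<n$ (with $r\ge 0$ and $n\geq 2$), the elementary set $\{a_1,\ldots,a_r;n\}$ is $\{\alpha\in X:\alpha_n=\{a_1,\ldots,a_r\}\}$; for $r=0$ it is written $\{.;n\}$ and consists of all sequences all of whose elements are $\ge n$. The function $\mu$ is defined recursively on elementary sets by (i) $\mu(\{.;2\})=1$; (ii) $\mu(\{a_1,\ldots,a_r,n;n+1\})=\prod_{i=1}^{r}\left(1-\frac1{a_i}\right)\mu(\{a_1,\ldots,a_r;n\})$; (iii) $\mu(\{a_1,\ldots,a_r;n+1\})=\left(1-\prod_{i=1}^{r}\left(1-\frac1{a_i}\right)\right)\mu(\{a_1,\ldots,a_r;n\})$, where an empty product equals $1$. It extends uniquely to a probability measure, also denoted $\mu$, on the $\sigma$-algebra generated by the elementary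 sets; ''almost every/almost surely'' refers to $\mu$. (Informally: given $\alpha_n$, the integer $n$ belongs to $\alpha$ with probability $\prod_{a\in\alpha_n}(1-1/a)$.) Here $f(x)\sim g(x)$ means $f(x)/g(x)\to1$. *)

(* Defs.v *)
From HB Require Import structures.
From mathcomp Require Import all_boot all_order all_algebra.
From mathcomp Require Import finmap.
From mathcomp Require Import all_classical all_reals all_analysis.
From mathcomp Require Import ring.

Set Implicit Arguments.
Unset Strict Implicit.
Unset Printing Implicit Defensive.

Import Order.TTheory GRing.Theory Num.Theory.
Import numFieldNormedType.Exports.

Local Open Scope classical_set_scope.
Local Open Scope ring_scope.

(* Strictly increasing (finite or infinite) sequences of integers > 1,
   identified with their sets of terms. *)
Definition incr_seq : Type :=
  set_type [set A : set nat | A `<=` [set n | (2 <= n)%N]].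

HB.instance Definition _ := Choice.on incr_seq.

Fact empty_incr_seq_subproof :
  set0 \in [set A : set nat | A `<=` [set n | (2 <= n)%N]].
Proof. by rewrite inE. Qed.

HB.instance Definition _ :=
  isPointed.Build incr_seq (exist _ set0 empty_incr_seq_subproof).

Definition in_seq (alpha : incr_seq) (n : nat) : Prop := sval alpha n.

(* [alpha `&` {2, ..., n - 1}]; the lower bound 2 is built into [incr_seq]. *)
Definition seq_below (alpha : incr_seq) (n : nat) : set nat :=
  [set j | in_seq alpha j /\ (j < n)%N].

(* [a] lists 2 <= a_1 < ... < a_r < n, with r = 0 allowed. *)
Definition admissible (a : seq nat) (n : nat) : bool :=
  [&& (2 <= n)%N, sorted ltn a & all (fun i => 2 <= i < n)%N a].

Definition elementary (a : seq nat) (n : nat) : set incr_seq :=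
  [set alpha | seq_below alpha n = [set` a]].

Definition elementary_sets : set (set incr_seq) :=
  [set E | exists a n, admissible a n /\ E = elementary a n].

Definition sieve_space := g_sigma_algebraType elementary_sets.

Section HawkinsMeasure.
Variable R : realType.

Definition survival (a : seq nat) : R := \prod_(i <- a) (1 - i%:R^-1).

(* The recursion determines the mass of every elementary set. These sets, with
   the empty set, form a pi-system generating the sigma-algebra of
   [sieve_space], so at most one probability satisfies this predicate; that one
   does is [hawkins_measure_exists] below. *)
Definition is_hawkins_measure (mu : probability sieve_space R) : Prop :=
  [/\ mu (elementary [::] 2) = 1%E,
      (forall a n, admissible a n ->
         mu (elementary (rcons a n) n.+1) =
           ((survival a)%:E * mu (elementary a n))%E)
    & (forall a n, admissible a n ->
         mu (elementary a n.+1) =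
           ((1 - survival a)%:E * mu (elementary a n))%E)].

Definition pair_set (k : nat) (x : R) (alpha : incr_seq) : set nat :=
  [set j : nat | [/\ j%:R <= x, in_seq alpha j & in_seq alpha (j + k)%N]].

Lemma finite_pair_set k x alpha : finite_set (pair_set k x alpha).
Proof.
apply: (@sub_finite_set _ _ `I_(Num.truncn `|x|).+1); last exact: finite_II.
move=> j [jx _ _] /=; rewrite ltnS truncn_ge_nat//.
exact: le_trans jx (ler_norm x).
Qed.

(* [fset_set] is the empty finite set on infinite sets, hence the finiteness
   lemma above. *)
Definition pair_count (k : nat) (x : R) (alpha : incr_seq) : nat :=
  #|` fset_set (pair_set k x alpha)|%N.

End HawkinsMeasure.

Lemma measurable_elementary a n :
  admissible a n -> measurable (elementary a n : set sieve_space).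
Proof. by move=> adm; apply: sub_gen_smallest; exists a, n. Qed.

(* Existence: push the uniform probability on `[0, 1] forward along a map into
   [sieve_space]. A point u is located in nested half-open intervals
   `[l, l + w[ with w = mu {a; n}; step n splits the current interval at
   l + survival a * w, and n is kept iff u falls in the left part. *)
Module Existence.
Section Existence.
Variable R : realType.

Lemma survival_itv (a : seq nat) n : admissible a n ->
  0 <= survival R a <= 1.
Proof.
case/and3P => _ _; rewrite /survival; elim: a => [|i a IH] /=.
  by rewrite big_nil ler01 lexx.
case/andP => /andP[i2 _] /IH /andP[h0 h1]; rewrite big_cons.
have i0 : (0 : R) < i%:R by rewrite ltr0n (leq_trans _ i2).
have h : 0 <= 1 - (i%:R^-1 : R) <= 1.
  have i1 : (i%:R^-1 : R) <= 1 by rewrite invf_le1// ler1n ltnW.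
  have i3 : 0 <= (i%:R^-1 : R) by rewrite invr_ge0 ltW.
  by rewrite subr_ge0 i1 lerBlDr lerDl i3.
case/andP: h => g0 g1.
by rewrite mulr_ge0//= mulr_ile1.
Qed.

(* Step m treats the integer m + 2. *)
Record state := State { st_a : seq nat; st_l : R; st_w : R }.

Definition cut (s : state) : R := st_l s + survival R (st_a s) * st_w s.

Fixpoint st (u : R) (m : nat) : state :=
  if m is m'.+1 then
    let s := st u m' in
    if u < cut s then
      State (rcons (st_a s) m'.+2) (st_l s) (survival R (st_a s) * st_w s)
    else State (st_a s) (cut s) ((1 - survival R (st_a s)) * st_w s)
  else State [::] 0 1.

Definition sieve_of_set (u : R) : set nat :=
  [set j | exists m, j = m.+2 /\ u < cut (st u m)].

Lemma sieve_of_subproof u :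
  sieve_of_set u \in [set A : set nat | A `<=` [set n | (2 <= n)%N]].
Proof. by rewrite inE /= => j [m [-> _]]. Qed.

Definition sieve_of (u : measurableTypeR R) : sieve_space :=
  exist _ (sieve_of_set u) (sieve_of_subproof u).

Lemma st_admissible u m : admissible (st_a (st u m)) m.+2.
Proof.
elim: m => [//|m]; rewrite /admissible => /and3P[_ sa /allP la] /=.
case: ifPn => _ /=; last first.
  by rewrite sa; apply/allP => i /la /andP[-> /leqW ->].
rewrite all_rcons ltnSn /=; apply/andP; split; last first.
  by apply/allP => i /la /andP[-> /leqW ->].
case: (st_a _) sa la => [//|i t] /= sa la.
rewrite rcons_path sa /=.
by case/andP: (la _ (mem_last i t)).
Qed.

Lemma st_below u m : seq_below (sieve_of u) m.+2 = [set` st_a (st u m)].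
Proof.
elim: m => [|m IH]; rewrite eqEsubset; split => j /=.
- by case=> -[m [-> _]].
- by [].
- case=> -[p [jE up]]; rewrite ltnS leq_eqVlt => /orP[/eqP jm|jm].
    move: jE; rewrite jm => -[] mp; rewrite -mp in up.
    by rewrite up /= mem_rcons in_cons eqxx.
  have : j \in st_a (st u m).
    have : [set` st_a (st u m)] j by rewrite -IH; split => //; exists p.
    by [].
  by case: ifPn => //= _; rewrite mem_rcons in_cons => ->; rewrite orbT.
- move=> jin.
  have [jm|/eqP jm] := eqVneq j m.+2.
    rewrite jm; split => //; rewrite jm in jin; exists m; split => //.
    move: jin; case: ifPn => //= _ jin.
    have /and3P[_ _ /allP /(_ _ jin)] := st_admissible u m.
    by rewrite ltnn andbF.
  have : [set` st_a (st u m)] j.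
    move: jin; case: ifPn => //= _; rewrite mem_rcons in_cons.
    by case/orP => // /eqP.
  by rewrite -IH => -[? ?]; split => //; exact: ltnW.
Qed.

Lemma admissible_inj a b m n : admissible a m -> admissible b n ->
  [set` a] = [set` b] -> a = b.
Proof.
move=> /and3P[_ sa _] /and3P[_ sb _] ab.
apply: (irr_sorted_eq ltn_trans ltnn sa sb) => j.
have E : [set` a] j <-> [set` b] j by rewrite ab.
by apply/idP/idP => h; apply/E.
Qed.

Lemma preimage_elementary a m : admissible a m.+2 ->
  sieve_of @^-1` elementary a m.+2 = [set u | st_a (st u m) = a].
Proof.
move=> adm; rewrite eqEsubset; split => u /=; rewrite /elementary /= st_below.
  by move=> /(admissible_inj (st_admissible u m) adm).
by move=> ->.
Qed.

Definition reached (a : seq nat) (m : nat) : set R :=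
  [set u | st_a (st u m) = a].

Definition good (a : seq nat) (m : nat) (l w : R) :=
  [/\ 0 <= l, 0 <= w, l + w <= 1,
      forall u, reached a m u -> st u m = State a l w
    & measurable (reached a m) /\
      reached a m `&` [set` `[0, 1[] = [set` `[l, l + w[]].

Lemma good0 : good [::] 0 0 1.
Proof.
split=> //; rewrite ?add0r//.
have -> : reached [::] 0 = setT by apply/seteqP.
by split; [exact: measurableT|rewrite setTI].
Qed.

Lemma good_in a m l w : admissible a m.+2 -> good a m l w ->
  good (rcons a m.+2) m.+1 l (survival R a * w).
Proof.
move=> adm [l0 w0 lw1 stE [mA AE]].
have /andP[p0 p1] := survival_itv adm.
have pw : survival R a * w <= w by rewrite ler_piMl.
have E : reached (rcons a m.+2) m.+1 =
    reached a m `&` [set` `]-oo, l + survival R a * w[].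
  rewrite eqEsubset; split => u; rewrite /reached /= in_itv /=.
    case: ifPn => /= [uc /rcons_inj[ha]|_ ha].
      by move: uc; rewrite (stE _ ha).
    have /and3P[_ _] := st_admissible u m.
    by rewrite ha all_rcons ltnn andbF.
  case=> ha; have -> := stE _ ha.
  by rewrite /cut /= => ->.
split => //.
- exact: mulr_ge0.
- by apply: le_trans lw1; rewrite lerD2l.
- move=> u; rewrite E => -[ha]; rewrite /= (stE _ ha) in_itv/= /cut/=.
  by move=> ->.
- rewrite E; split; first by apply: measurableI => //; exact: measurable_itv.
  rewrite setIAC AE eqEsubset; split => u /=; rewrite !in_itv/=.
    by case=> /andP[-> _] ->.
  case/andP => -> h; split => //=.
  by apply: lt_le_trans h _; rewrite lerD2l.
Qed.

Lemma good_out a m l w : admissible a m.+2 -> good a m l w ->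
  good a m.+1 (l + survival R a * w) ((1 - survival R a) * w).
Proof.
move=> adm [l0 w0 lw1 stE [mA AE]].
have /andP[p0 p1] := survival_itv adm.
have pw : survival R a * w <= w by rewrite ler_piMl.
have pw0 : 0 <= survival R a * w by rewrite mulr_ge0.
have eE : l + survival R a * w + (1 - survival R a) * w = l + w by ring.
have E : reached a m.+1 =
    reached a m `&` [set` `[l + survival R a * w, +oo[].
  rewrite eqEsubset; split => u; rewrite /reached /= in_itv /= andbT.
    case: ifPn => /= [_ ha|uc ha].
      have /and3P[_ _] := adm.
      by rewrite -ha all_rcons ltnn andbF.
    by split => //; rewrite leNgt; move: uc; rewrite (stE _ ha).
  case=> ha; have -> := stE _ ha.
  by rewrite /cut /= ltNge => ->.
split => //.
- exact: addr_ge0.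
- by rewrite mulr_ge0// subr_ge0.
- by rewrite eE.
- move=> u; rewrite E => -[ha]; rewrite /= (stE _ ha) in_itv/= /cut/= andbT.
  by rewrite ltNge => ->.
- rewrite E; split; first by apply: measurableI => //; exact: measurable_itv.
  rewrite eE setIAC AE eqEsubset; split => u /=; rewrite !in_itv/= ?andbT.
    by case=> /andP[_ ->] ->.
  case/andP => h ->; split => //; rewrite andbT.
  by apply: le_trans h; rewrite lerDl.
Qed.

Lemma admissible_rcons_inv a m : admissible a m.+3 ->
  admissible a m.+2 \/ exists2 b, admissible b m.+2 & a = rcons b m.+2.
Proof.
case/and3P => _; case/lastP: a => [|b i]; first by left.
rewrite all_rcons -cats1 => sab /andP[/andP[i2 im] /allP lb].
have /andP[sb ib] : sorted ltn b && all (fun j => j < i)%N b.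
  move: sab; rewrite (sorted_pairwise ltn_trans) pairwise_cat allrel1r.
  by rewrite -(sorted_pairwise ltn_trans) => /and3P[-> -> _].
have lb' : all (fun j => 2 <= j < i)%N b.
  by apply/allP => j jb; case/andP: (lb _ jb) => -> _; exact: (allP ib).
move: im; rewrite ltnS leq_eqVlt => /orP[/eqP im|im].
  right; exists b; last by rewrite cats1 im.
  by rewrite -im /admissible sb i2 lb'.
left; rewrite /admissible sab all_cat /= i2 im /= andbT.
apply/allP => j /(allP lb') /andP[-> /= ji]; exact: ltn_trans im.
Qed.

Lemma good_ex a m : admissible a m.+2 -> exists l w, good a m l w.
Proof.
elim: m a => [|m IH] a.
  case: a => [_|i a /and3P[_ _ /= /andP[/andP[i2]]]].
    by exists 0, 1; exact: good0.
  by rewrite ltnNge i2.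
case/admissible_rcons_inv => [h|[b h ->]].
  have [l [w g]] := IH _ h.
  by exists (l + survival R a * w), ((1 - survival R a) * w); exact: good_out.
have [l [w g]] := IH _ h.
by exists l, (survival R b * w); exact: good_in.
Qed.

Lemma admissible_ge2 a n : admissible a n -> exists m, n = m.+2.
Proof. by case: n => [|[|m]] /and3P[]// _ _ _; exists m. Qed.

Lemma measurable_sieve_of : measurable_fun [set: measurableTypeR R] sieve_of.
Proof.
apply: (@measurability _ _ _ sieve_space setT sieve_of elementary_sets erefl).
move=> _ [_ [a [n [adm ->]]] <-]; rewrite setTI.
have [m nm] := admissible_ge2 adm; subst n.
rewrite preimage_elementary//.
by have [l [w [_ _ _ _ []]]] := good_ex adm.
Qed.

Definition unit_prob : probability (measurableTypeR R) R := uniform_prob (@ltr01 R).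

Lemma unit_probE (A : set (measurableTypeR R)) (l w : R) : measurable A -> 0 <= l -> 0 <= w -> l + w <= 1 ->
  A `&` [set` `[0, 1[] = [set` `[l, l + w[] -> unit_prob A = w%:E.
Proof.
move=> mA l0 w0 lw AE.
have itvE (a b : R) : 0 <= a -> 0 <= b -> a + b <= 1 ->
    unit_prob [set` `[a, a + b[] = b%:E.
  move=> a0 b0 ab.
  transitivity (\int[@lebesgue_measure R]_(x in [set` `[a, a + b[]%R) 1%:E)%E.
    apply: eq_integral => x; rewrite inE /= in_itv /= => /andP[ax xb].
    rewrite /uniform_pdf (le_trans a0 ax) (le_trans (ltW xb) ab) /=.
    by rewrite subr0 invr1.
  rewrite integral_cst//.
  rewrite mul1e; transitivity (@lebesgue_measure R [set` `[a, a + b[]); first by [].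
  rewrite lebesgue_measure_itv /= lte_fin ltrDl.
  case: ifPn => [_|]; first by rewrite -EFinD addrAC subrr add0r.
  by rewrite -leNgt => b0'; congr EFin; apply/le_anti/andP.
pose I := [set` `[(0 : R), 1[] : set (measurableTypeR R).
have mI : measurable I by exact: measurable_itv.
rewrite -(setUIDK A I) measureU; last first.
- by rewrite setIDA setDE setIAC -setIA; apply/seteqP; split => // x [[? ?] []].
- exact: measurableD.
- exact: measurableI.
rewrite AE.
transitivity (w%:E + unit_prob (A `\` I))%E.
  by congr (_ + _)%E; exact: itvE.
suff -> : unit_prob (A `\` I) = 0%E by rewrite adde0.
apply/eqP; rewrite eq_le measure_ge0 andbT.
apply: (@le_trans _ _ (unit_prob (~` I))).
  apply: le_measure; rewrite ?inE; last by move=> x [].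
  - exact: measurableD.
  - exact: measurableC.
rewrite probability_setC//.
have := @itvE 0 1; rewrite add0r => I1.
by rewrite (I1 (lexx _) ler01 (lexx _)) subee.
Qed.

HB.instance Definition _ :=
  isMeasurableFun.Build _ _ _ _ sieve_of measurable_sieve_of.

Lemma good_mu a m l w : admissible a m.+2 -> good a m l w ->
  distribution unit_prob sieve_of (elementary a m.+2) = w%:E.
Proof.
move=> adm [l0 w0 lw _ [mA AE]].
rewrite /distribution /pushforward preimage_elementary//.
exact: unit_probE AE.
Qed.

Lemma admissible_rcons a n : admissible a n -> admissible (rcons a n) n.+1.
Proof.
case/and3P => n2 sa /allP la; rewrite /admissible ltnW// all_rcons n2 ltnSn /=.
apply/andP; split; last by apply/allP => i /la /andP[-> /leqW].
case: a sa la => [//|i t] /= sa la.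
by rewrite rcons_path sa /=; case/andP: (la _ (mem_last i t)).
Qed.

Lemma admissibleS a n : admissible a n -> admissible a n.+1.
Proof.
case/and3P => n2 sa /allP la; rewrite /admissible ltnW// sa.
by apply/allP => i /la /andP[-> /leqW].
Qed.

Lemma hawkins_measure_exists :
  exists mu : probability sieve_space R, is_hawkins_measure mu.
Proof.
exists (distribution unit_prob sieve_of); split.
- exact: (@good_mu [::] 0 0 1 isT good0).
- move=> a n adm; have [m nm] := admissible_ge2 adm; subst n.
  have [l [w g]] := good_ex adm.
  apply: etrans (good_mu (admissible_rcons adm) (good_in adm g)) _.
  by rewrite EFinM; congr (_ * _)%E; exact/esym/(good_mu adm g).
- move=> a n adm; have [m nm] := admissible_ge2 adm; subst n.
  have [l [w g]] := good_ex adm.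
  apply: etrans (good_mu (admissibleS adm) (good_out adm g)) _.
  by rewrite EFinM; congr (_ * _)%E; exact/esym/(good_mu adm g).
Qed.
End Existence.
End Existence.

Definition hawkins_measure_exists := Existence.hawkins_measure_exists.

(* Main.v *)
(** Let [q n] be the probability, given the sieve below [n + 2], that [n + 2] is
    kept. Then [1 / q n] minus [1 + (1 + 1/2 + ... + 1/n)] is a martingale whose
    variance is at most the harmonic sum, so [q n] is almost surely equivalent to
    [1 / log n], by Chebyshev along the times [2 ^ (j ^ 2)] and monotonicity of
    [q]. Writing [X i] for the indicator of [i + 2], the pair count is

      [sum X_i X_(i+k) = sum X_i (X_(i+k) - q_(i+k)) + sum q_i (X_i - q_i)
                         + sum q_i ^ 2 - sum X_i (q_i - q_(i+k))].

    The first two sums are martingales of variance [O(n)], negligible along the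
    times [(j + 1) ^ 6]; the last one lies in [[0, k]] because [q] is
    nonincreasing; and [sum q_i ^ 2] is equivalent to [n / (log n) ^ 2]. *)
Require Import Defs.
From mathcomp Require Import all_boot all_order all_algebra.
From mathcomp Require Import finmap.
From mathcomp Require Import all_classical all_reals all_analysis.
From mathcomp Require Import measurable_realfun ring lra.
Import Order.TTheory GRing.Theory Num.Theory.
Import numFieldNormedType.Exports.
Set Implicit Arguments.
Unset Strict Implicit.
Unset Printing Implicit Defensive.
Local Open Scope classical_set_scope.
Local Open Scope ring_scope.

(** * The sieve as a Markov chain on bit lists *)

Section Chain.
Variable R : realType.
Implicit Types (b : seq bool) (f g h : seq bool -> R).

(* A state is the list of the decisions taken so far, most recent first. The
   decision at time [i] concerns the integer [i + 2]. *)
Fixpoint keep b : R :=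
  if b is x :: b' then keep b' * (1 - x%:R / (size b').+2%:R) else 1.

(* One-step conditional expectation, so [iter n step f [::]] is the mean of [f]
   over the states of size [n]. *)
Definition step f b : R :=
  keep b * f (true :: b) + (1 - keep b) * f (false :: b).

(** The martingale transform of the centred decisions [x - keep b'] by the weight [h b'], which
    depends only on the past. *)
Fixpoint mart h b : R :=
  if b is x :: b' then mart h b' + h b' * (x%:R - keep b') else 0.

Lemma keep_factor (x : bool) (n : nat) :
  0 < (1 - x%:R / n.+2%:R : R) <= 1.
Proof.
have n2 : (0 : R) < n.+2%:R by rewrite ltr0n.
case: x; last by rewrite mul0r subr0 ltr01 lexx.
rewrite mul1r subr_gt0 invf_lt1// ltr1n /= lerBlDr lerDl invr_ge0.
exact: ltW.
Qed.

Lemma keep_gt0 b : 0 < keep b.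
Proof.
elim: b => [|x b IH] /=; first exact: ltr01.
by rewrite mulr_gt0//; case/andP: (keep_factor x (size b)).
Qed.

Lemma keep_cons_le x b : keep (x :: b) <= keep b.
Proof.
by rewrite /= ler_piMr ?(ltW (keep_gt0 b))//; case/andP: (keep_factor x (size b)).
Qed.

Lemma keep_le1 b : keep b <= 1.
Proof. by elim: b => [//|x b IH]; exact: le_trans (keep_cons_le x b) IH. Qed.

Lemma step_le f g b : f (true :: b) <= g (true :: b) ->
  f (false :: b) <= g (false :: b) -> step f b <= step g b.
Proof.
move=> h1 h2; apply: lerD; apply: ler_wpM2l => //.
  exact: ltW (keep_gt0 b).
by rewrite subr_ge0 keep_le1.
Qed.

Lemma iter_step_le n f g b :
  (forall b', size b' = (n + size b)%N -> f b' <= g b') ->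
  iter n step f b <= iter n step g b.
Proof.
elim: n b => [|n IH] b fg /=; first exact: fg.
by apply: step_le; apply: IH => b' sb'; apply: fg; rewrite sb' addnS.
Qed.

Lemma iter_step_eq n f g b :
  (forall b', size b' = (n + size b)%N -> f b' = g b') ->
  iter n step f b = iter n step g b.
Proof.
by move=> fg; apply/le_anti/andP; split; apply: iter_step_le => b' /fg ->.
Qed.

Lemma iter_step_cst n (c : R) b : iter n step (fun=> c) b = c.
Proof.
by elim: n b => [//|n IH] b /=; rewrite /step !IH; ring.
Qed.

Lemma iter_stepD n f g b :
  iter n step (fun b => f b + g b) b = iter n step f b + iter n step g b.
Proof. by elim: n b => [//|n IH] b /=; rewrite /step !IH; ring. Qed.

Lemma iter_stepZ n (c : R) f b :
  iter n step (fun b => c * f b) b = c * iter n step f b.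
Proof. by elim: n b => [//|n IH] b /=; rewrite /step !IH; ring. Qed.

Lemma iter_step_ge0 n f b : (forall b, 0 <= f b) -> 0 <= iter n step f b.
Proof.
by move=> f0; rewrite -(iter_step_cst n 0 b); apply: iter_step_le.
Qed.

(** Here [g] is the conditional mean of the increment of [f], so its accumulated means account for
    the whole change in the mean of [f]. *)
Lemma iter_step_sum f g : (forall b, step f b = f b + g b) ->
  forall n, iter n step f [::] = f [::] + \sum_(m < n) iter m step g [::].
Proof.
move=> fg; elim=> [|n IH]; first by rewrite big_ord0 addr0.
rewrite iterSr (iter_step_eq (g := fun b => f b + g b))// iter_stepD.
by rewrite IH big_ord_recr/= addrA.
Qed.

(** Orthogonality of the increments: the cross term has conditional mean 0, and a decision has
    conditional variance [keep b * (1 - keep b)]. *)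
Lemma mart_sqr h n : iter n step (fun b => mart h b ^+ 2) [::] =
  \sum_(m < n) iter m step (fun b => h b ^+ 2 * (keep b * (1 - keep b))) [::].
Proof.
rewrite (iter_step_sum (g := fun b => h b ^+ 2 * (keep b * (1 - keep b)))).
  by rewrite /= expr0n add0r.
by move=> b; rewrite /step /=; ring.
Qed.

Lemma mart_sqr_le h n : (forall b, 0 <= h b <= 1) ->
  iter n step (fun b => mart h b ^+ 2) [::] <= n%:R.
Proof.
move=> h01; rewrite mart_sqr.
have -> : n%:R = \sum_(m < n) (1 : R) by rewrite sumr_const card_ord.
apply: ler_sum => m _; rewrite -[leRHS](iter_step_cst m 1 [::]).
apply: iter_step_le => b _.
have /andP[h0 h1] := h01 b.
have k1 := keep_le1 b; have k0 := ltW (keep_gt0 b).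
rewrite mulr_ile1 ?exprn_ile1 ?mulr_ge0 ?subr_ge0 ?exprn_ge0//.
by rewrite mulr_ile1 ?subr_ge0// lerBlDr lerDl.
Qed.

(** * Mean and variance of the reciprocal keeping probability *)

Definition harmonic_sum n : R := \sum_(i < n) i.+1%:R^-1.

Lemma harmonic_sumS n : harmonic_sum n.+1 = harmonic_sum n + n.+1%:R^-1.
Proof. by rewrite /harmonic_sum big_ord_recr. Qed.

Lemma harmonic_sum_ge0 n : 0 <= harmonic_sum n.
Proof. by apply: sumr_ge0 => i _; rewrite invr_ge0. Qed.

Lemma harmonic_sum_le n : harmonic_sum n <= n%:R.
Proof.
have -> : n%:R = \sum_(m < n) (1 : R) by rewrite sumr_const card_ord.
by apply: ler_sum => i _; rewrite invf_le1// ler1n.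
Qed.

(* [1 / keep] grows by the factor [1 + x / (n + 1)], of conditional mean
   [1 + keep / (n + 1)], so its compensator is the deterministic harmonic sum. *)
Lemma keepV_cons x b :
  (keep (x :: b))^-1 = (keep b)^-1 + (keep b)^-1 * x%:R / (size b).+1%:R.
Proof.
have k0 := lt0r_neq0 (keep_gt0 b).
have n1 : ((size b).+1%:R : R) != 0 by rewrite pnatr_eq0.
have -> : keep (x :: b) = keep b * (1 - x%:R / (size b).+2%:R) by [].
case: x; last by rewrite mul0r subr0 !mulr0 mul0r addr0 mulr1.
have n2' : ((size b).+1%:R + 1 : R) != 0 by rewrite natr1.
have -> : (true%:R : R) = 1 by [].
rewrite -[(size b).+2%:R]natr1; move: n1 n2' k0.
move: ((size b).+1%:R : R) (keep b) => m K n1 n2 k0; field.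
by rewrite n1 n2 k0.
Qed.

(** The compensator step [1 / (n + 1)] is the weight times [keep], so subtracting it from the
    increment of [1 / keep] leaves the weight times [x - keep]. *)
Lemma keepV_mart b :
  mart (fun b => (keep b)^-1 / (size b).+1%:R) b =
  (keep b)^-1 - (1 + harmonic_sum (size b)).
Proof.
elim: b => [|x b IH].
  by rewrite /= /harmonic_sum big_ord0 invr1; ring.
rewrite keepV_cons [LHS]/= IH [size (x :: b)]/= harmonic_sumS.
have k0 := lt0r_neq0 (keep_gt0 b).
have n1 : ((size b).+1%:R : R) != 0 by rewrite pnatr_eq0.
move: k0 n1; move: (keep b) ((size b).+1%:R : R) => K m k0 n1.
by field; rewrite n1 k0.
Qed.

Lemma keepV_mean n :
  iter n step (fun b => (keep b)^-1) [::] = 1 + harmonic_sum n.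
Proof.
rewrite (iter_step_sum (g := fun b => (size b).+1%:R^-1)); last first.
  move=> b; rewrite /step !keepV_cons.
  have k0 := lt0r_neq0 (keep_gt0 b).
  have n1 : ((size b).+1%:R : R) != 0 by rewrite pnatr_eq0.
  move: k0 n1; move: (keep b) ((size b).+1%:R : R) => K m k0 n1.
  have -> : (true%:R : R) = 1 by [].
  have -> : (false%:R : R) = 0 by [].
  by field; rewrite n1 k0.
rewrite /= invr1; congr (_ + _); apply: eq_bigr => m _.
rewrite -[RHS](iter_step_cst m _ [::]).
by apply: iter_step_eq => b; rewrite addn0 => ->.
Qed.

(** The squared increment at time [m] has conditional mean at most [(m + 1) ^- 2 / keep]. Its mean
    is at most [(1 + harmonic_sum m) / (m + 1) ^ 2], hence at most [1 / (m + 1)]. *)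
Lemma keepV_var n :
  iter n step (fun b => ((keep b)^-1 - (1 + harmonic_sum (size b))) ^+ 2) [::]
    <= harmonic_sum n.
Proof.
under [X in iter _ _ X _]funext do rewrite -keepV_mart.
rewrite mart_sqr; apply: ler_sum => m _.
apply: (@le_trans _ _ (iter m step (fun b => m.+1%:R ^- 2 * (keep b)^-1) [::])).
  apply: iter_step_le => b; rewrite addn0 => ->.
  have k0 := keep_gt0 b; have k1 := keep_le1 b.
  have n1 : (m.+1%:R : R) != 0 by rewrite pnatr_eq0.
  have -> : ((keep b)^-1 / m.+1%:R) ^+ 2 * (keep b * (1 - keep b)) =
      m.+1%:R ^- 2 * (keep b)^-1 * (1 - keep b).
    move: (lt0r_neq0 k0) n1; move: (keep b) (m.+1%:R : R) k0 k1 => K M k0 k1 k0' n1.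
    by field; rewrite n1 k0'.
  rewrite ler_piMr//; last by rewrite lerBlDr lerDl ltW.
  by rewrite mulr_ge0// ?invr_ge0 ?exprn_ge0// ltW.
rewrite iter_stepZ keepV_mean -exprVn expr2 -mulrA ler_piMr ?invr_ge0//.
rewrite mulrC ler_pdivrMr ?ltr0n// mul1r -natr1 addrC lerD2r.
exact: harmonic_sum_le.
Qed.

End Chain.

(** * The chain under the Hawkins measure *)

Definition bit (alpha : incr_seq) (i : nat) : bool := `[< in_seq alpha i.+2 >].

Fixpoint bits (alpha : incr_seq) (n : nat) : seq bool :=
  if n is n'.+1 then bit alpha n' :: bits alpha n' else [::].

Lemma size_bits alpha n : size (bits alpha n) = n.
Proof. by elim: n => //= n ->. Qed.

(** The newest decision heads [b] but concerns the largest integer, so [rcons] keeps the list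
    increasing, as [admissible] demands. *)
Fixpoint elems (b : seq bool) : seq nat :=
  if b is x :: b' then
    if x then rcons (elems b') (size b').+2 else elems b'
  else [::].

Lemma elems_admissible b : admissible (elems b) (size b).+2.
Proof.
elim: b => [//|[] b IH].
  exact: Existence.admissible_rcons.
exact: Existence.admissibleS.
Qed.

Lemma elems_lt b j : j \in elems b -> (j < (size b).+2)%N.
Proof. by case/and3P: (elems_admissible b) => _ _ /allP h /h /andP[]. Qed.

Lemma elems_cons x b j : (j \in elems (x :: b)) =
  (x && (j == (size b).+2)) || (j \in elems b).
Proof. by case: x => //=; rewrite mem_rcons in_cons. Qed.

(** The integer decided by the head exceeds all those of the tail, so its membership alone
    determines the head. *)
Lemma elems_inj b c : size b = size c -> elems b =i elems c -> b = c.
Proof.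
elim: b c => [|x b IH] [|y c]//= [sbc] e.
have notin d : (size d).+2 \notin elems d.
  by apply/negP => /elems_lt; rewrite ltnn.
have nb := notin b; have nc := notin c; rewrite sbc in nb.
have xy : x = y.
  have := e (size b).+2; rewrite !elems_cons sbc eqxx !andbT.
  by rewrite (negbTE nb) (negbTE nc) !orbF.
rewrite xy; congr cons; apply: IH => // j.
have := e j; rewrite !elems_cons xy sbc.
have [->|jn] := eqVneq j (size c).+2; last by rewrite andbF.
by rewrite (negbTE nb) (negbTE nc).
Qed.

Lemma mem_elems_bits alpha n j :
  j \in elems (bits alpha n) <-> in_seq alpha j /\ (j < n.+2)%N.
Proof.
elim: n => [|n IH].
  split=> // -[aj j2].
  have : sval alpha `<=` [set n | (2 <= n)%N].
    by have := svalP alpha; rewrite inE.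
  by move=> /(_ _ aj) /=; rewrite leqNgt j2.
rewrite [bits _ _]/= elems_cons size_bits ltnS leq_eqVlt.
split.
  case/orP => [/andP[/asboolP aj /eqP->]|/IH[? ->]]; first by rewrite eqxx.
  by rewrite orbT.
case=> aj /orP[/eqP jn|jn]; apply/orP; [left|right; exact/IH].
by rewrite jn eqxx andbT; apply/asboolP; rewrite -jn.
Qed.

Lemma elementaryE b :
  elementary (elems b) (size b).+2 = [set alpha | bits alpha (size b) = b].
Proof.
apply/seteqP; split => alpha /= h.
  apply: elems_inj; first exact: size_bits.
  move=> j.
  have e : [set` elems b] j <-> seq_below alpha (size b).+2 j by rewrite h.
  by apply/idP/idP => [/mem_elems_bits/e//|/e/mem_elems_bits].
rewrite /elementary /mkset -[in RHS]h.
apply/seteqP; split => j; first by move/mem_elems_bits.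
by move/mem_elems_bits.
Qed.

Section Link.
Variables (R : realType) (mu : probability sieve_space R).
Hypothesis hmu : is_hawkins_measure mu.

Definition cylinder b : set sieve_space := [set alpha | bits alpha (size b) = b].

Lemma measurable_cylinder b : measurable (cylinder b).
Proof.
rewrite /cylinder -elementaryE.
exact: measurable_elementary (elems_admissible b).
Qed.

Lemma survival_elems b : survival R (elems b) = keep R b.
Proof.
elim: b => [|[] b IH]; first by rewrite /survival big_nil.
  rewrite /survival /= -cats1 big_cat big_seq1 -/(survival R (elems b)) IH.
  by rewrite mul1r.
by rewrite /= mul0r subr0 mulr1.
Qed.

Lemma mu_cylinder_nil : mu (cylinder [::]) = 1%E.
Proof. by case: hmu => h _ _; rewrite /cylinder -elementaryE. Qed.

Lemma mu_cylinder_true b :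
  mu (cylinder (true :: b)) = ((keep R b)%:E * mu (cylinder b))%E.
Proof.
case: hmu => _ h _; rewrite /cylinder -!elementaryE -survival_elems.
exact: h (elems_admissible b).
Qed.

Lemma mu_cylinder_false b :
  mu (cylinder (false :: b)) = ((1 - keep R b)%:E * mu (cylinder b))%E.
Proof.
case: hmu => _ _ h; rewrite /cylinder -!elementaryE -survival_elems.
exact: h (elems_admissible b).
Qed.

Lemma cylinder_split b :
  cylinder b = cylinder (true :: b) `|` cylinder (false :: b).
Proof.
apply/seteqP; split => alpha; rewrite /cylinder /=.
  by move=> ->; case: (bit _ _); [left|right].
by case=> -[].
Qed.

Lemma measurable_bits_cylinder (f : seq bool -> \bar R) n b :
  measurable_fun (cylinder b) (fun alpha => f (bits alpha (n + size b)%N)).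
Proof.
elim: n b => [|n IH] b.
  apply: (@eq_measurable_fun _ _ _ _ _ (fun=> f b)).
    by move=> alpha; rewrite inE => h; rewrite add0n h.
  exact: measurable_cst.
rewrite cylinder_split measurable_funU; try exact: measurable_cylinder.
by rewrite addSnnS; split; [exact: (IH (true :: b))|exact: (IH (false :: b))].
Qed.

(** Splitting a cylinder on its next decision weights the two halves by [keep] and [1 - keep], which
    is one application of [step]. This turns means of the chain into integrals. *)
Lemma integral_bits_cylinder (f : seq bool -> R) n b : (forall b, 0 <= f b) ->
  (\int[mu]_(alpha in cylinder b) (f (bits alpha (n + size b)%N))%:E =
   (iter n (@step R) f b)%:E * mu (cylinder b))%E.
Proof.
move=> f0; elim: n b => [|n IH] b.
  rewrite (eq_integral (fun=> (f b)%:E)).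
    by rewrite integral_cst//; exact: measurable_cylinder.
  by move=> alpha; rewrite inE => h; rewrite add0n h.
rewrite [in LHS]cylinder_split ge0_integral_setU.
- rewrite addSnnS (IH (true :: b)) (IH (false :: b)).
  rewrite mu_cylinder_true mu_cylinder_false !muleA -!EFinM /= /step EFinD.
  rewrite ge0_muleDl ?lee_fin.
  + by congr (_%:E * _ + _%:E * _)%E; rewrite mulrC.
  + by apply: mulr_ge0; [exact: ltW (keep_gt0 _ _)|exact: iter_step_ge0].
  + by apply: mulr_ge0; [rewrite subr_ge0 keep_le1|exact: iter_step_ge0].
- exact: measurable_cylinder.
- exact: measurable_cylinder.
- rewrite -cylinder_split.
  exact: (measurable_bits_cylinder (fun b => (f b)%:E)).
- by move=> alpha _; rewrite lee_fin.
- by apply/disj_setPS => alpha; rewrite /cylinder /= => -[[e _] [e' _]]; rewrite e in e'.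
Qed.

Lemma cylinder_nil : cylinder [::] = setT.
Proof. by apply/seteqP; split. Qed.

Lemma measurable_bits (f : seq bool -> \bar R) n :
  measurable_fun [set: sieve_space] (fun alpha => f (bits alpha n)).
Proof.
by have := @measurable_bits_cylinder f n [::]; rewrite cylinder_nil addn0.
Qed.

Lemma integral_bits (f : seq bool -> R) n : (forall b, 0 <= f b) ->
  (\int[mu]_alpha (f (bits alpha n))%:E)%E = (iter n (@step R) f [::])%:E.
Proof.
move=> f0; have := @integral_bits_cylinder f n [::] f0.
by rewrite mu_cylinder_nil cylinder_nil addn0 mule1.
Qed.

(** This does the work of Chebyshev and Borel-Cantelli: the series of the [Z j] has finite integral,
    so it converges almost everywhere and its terms tend to 0. *)
Lemma ae_cvg0_bits (n_ : nat -> nat) (Z : nat -> seq bool -> R) (C : R) :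
  (forall j b, 0 <= Z j b) ->
  (forall N, \sum_(j < N) iter (n_ j) (@step R) (Z j) [::] <= C) ->
  {ae mu, forall alpha, Z j (bits alpha (n_ j)) @[j --> \oo] --> (0 : R)}.
Proof.
move=> Z0 ZC.
pose F j (alpha : sieve_space) := (Z j (bits alpha (n_ j)))%:E.
have F0 j alpha : (0 <= F j alpha)%E by rewrite lee_fin.
have mF j : measurable_fun setT (F j).
  exact: (measurable_bits (fun b => (Z j b)%:E)).
have intF : mu.-integrable setT (fun alpha => \sum_(0 <= j <oo) F j alpha)%E.
  apply/integrableP; split; first exact: ge0_emeasurable_sum.
  under eq_integral do rewrite gee0_abs ?nneseries_ge0//.
  rewrite integral_nneseries//.
  apply: (@le_lt_trans _ _ C%:E); last exact: ltry.
  apply: lime_le.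
    by apply: is_cvg_nneseries => *; apply: integral_ge0.
  apply: nearW => N; rewrite big_mkord.
  under eq_bigr do rewrite integral_bits//.
  by rewrite sumEFin lee_fin.
apply: filterS (integrable_ae measurableT intF) => alpha /(_ I) fin.
apply: (@cvg_series_cvg_0 _ R^o).
have cF := @is_cvg_nneseries _ (fun j => F j alpha) xpredT 0%N (fun j _ _ => F0 j alpha).
apply/cvg_ex; exists (fine (\sum_(0 <= j <oo) F j alpha)%E).
have h : (\sum_(0 <= j < n) F j alpha)%E @[n --> \oo] -->
    (fine (\sum_(0 <= j <oo) F j alpha)%E)%:E by rewrite fineK.
rewrite (_ : series _ = fine \o (fun n => \sum_(0 <= j < n) F j alpha)%E).
  exact: fine_cvg h.
by apply/funext => n /=; rewrite sumEFin.
Qed.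
End Link.

(** * Limits of sequences *)

Section Asymptotics.
Variable R : realType.
Implicit Types u g w r : nat -> R.

Lemma cvg_sqr0 {T : Type} {F : set_system T} {FF : Filter F} (f : T -> R) :
  f x ^+ 2 @[x --> F] --> 0 -> f x @[x --> F] --> 0.
Proof.
move=> /cvgrPdist_le h; apply/cvgrPdist_le => e e0.
have := h (e ^+ 2) (exprn_gt0 2 e0); apply: filterS => x.
by rewrite !sub0r !normrN normrX ler_pXn2r ?nnegrE ?normr_ge0 ?(ltW e0).
Qed.

Lemma cvg_ext {T : Type} {F : set_system T} {FF : Filter F} (f g : T -> R)
  (l m : R) : f x @[x --> F] --> l -> {near F, f =1 g} -> l = m ->
  g x @[x --> F] --> m.
Proof.
move=> fl fg <-; apply: cvg_trans fl; apply: near_eq_cvg.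
by apply: filterS fg => x ->.
Qed.

(** Weighted Cesaro means: the terms before [r] gets close to [l] contribute a constant, which the
    diverging total weight absorbs. *)
Lemma toeplitz w r (l : R) : (forall i, 0 <= w i) ->
  (\sum_(i < n) w i @[n --> \oo] --> +oo) -> r n @[n --> \oo] --> l ->
  (\sum_(i < n) w i * r i) / (\sum_(i < n) w i) @[n --> \oo] --> l.
Proof.
move=> w0 /cvgryPge Woo /cvgrPdist_le rl; apply/cvgrPdist_le => e e0.
have e2 : 0 < e / 2 by rewrite divr_gt0.
have [N _ rN] := rl _ e2.
pose K := \sum_(i < N) w i * `|l - r i|.
have K0 : 0 <= K by apply: sumr_ge0 => i _; rewrite mulr_ge0.
have bound m : `|\sum_(i < N + m) w i * (l - r i)| <=
    K + e / 2 * \sum_(i < N + m) w i.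
  elim: m => [|m IH].
    rewrite addn0 (le_trans (ler_norm_sum _ _ _))//.
    under eq_bigr do rewrite normrM (ger0_norm (w0 _)).
    by rewrite lerDl mulr_ge0 ?sumr_ge0// ltW.
  rewrite addnS !big_ord_recr/= [in leRHS]mulrDr addrA (le_trans (ler_normD _ _))//.
  apply: lerD IH _; rewrite normrM (ger0_norm (w0 _)) mulrC ler_wpM2r//.
  by apply: rN; rewrite /= leq_addr.
near=> n; rewrite /=.
(* This makes [K] at most [e / 2] times the total weight; the extra 1 keeps that weight positive. *)
have W1 : 2 * K / e + 1 <= \sum_(i < n) w i by near: n; exact: Woo.
have Wp : 0 < \sum_(i < n) w i.
  have Ke : 0 <= 2 * K / e by rewrite divr_ge0 ?mulr_ge0// ltW.
  by apply: lt_le_trans W1; lra.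
have -> : l - (\sum_(i < n) w i * r i) / (\sum_(i < n) w i) =
    (\sum_(i < n) w i * (l - r i)) / \sum_(i < n) w i.
  under [in RHS]eq_bigr do rewrite mulrBr.
  rewrite sumrB -mulr_suml; move: (\sum_(i < n) w i * r i) => S.
  by move: Wp; move: (\sum_(i < n) w i) => W /lt0r_neq0 W0; field.
rewrite normrM normfV (gtr0_norm Wp) ler_pdivrMr//.
have Nn : (N <= n)%N by near: n; exact: nbhs_infty_ge.
have := bound (n - N)%N; rewrite subnKC// => bn.
apply: (le_trans bn); move: W1; rewrite -(ler_pM2l e2).
set W := \sum_(i < n) w i; move=> W1.
have : e / 2 * (2 * K / e + 1) = K + e / 2 by field; rewrite lt0r_neq0.
move=> E; rewrite E in W1; lra.
Unshelve. all: by end_near. Qed.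

(** Between two consecutive times, monotonicity puts [u n / g n] between [u (n_ j) / g (n_ j.+1)]
    and [u (n_ j.+1) / g (n_ j)], both of limit 1. *)
Lemma cvg_ratio_subseq u g (n_ : nat -> nat) :
  (forall n, 0 <= u n) -> {homo u : m n / (m <= n)%N >-> m <= n} ->
  (forall n, (0 < n)%N -> 0 < g n) -> {homo g : m n / (m <= n)%N >-> m <= n} ->
  (forall j, (0 < n_ j)%N) -> (forall j, (j <= n_ j)%N) ->
  g (n_ j.+1) / g (n_ j) @[j --> \oo] --> (1 : R) ->
  u (n_ j) / g (n_ j) @[j --> \oo] --> (1 : R) ->
  u n / g n @[n --> \oo] --> (1 : R).
Proof.
move=> u0 um g0 gm n0 nge gg ug.
have gp j := g0 _ (n0 j).
have up : u (n_ j.+1) / g (n_ j) @[j --> \oo] --> (1 : R).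
  have ugS : u (n_ j.+1) / g (n_ j.+1) @[j --> \oo] --> (1 : R).
    by rewrite (cvg_shiftS (fun j => u (n_ j) / g (n_ j))).
  apply: (cvg_ext (cvgM ugS gg)); last by rewrite mulr1.
  by apply: nearW => j /=; rewrite mulrA divfK// lt0r_neq0.
have lo : u (n_ j) / g (n_ j.+1) @[j --> \oo] --> (1 : R).
  apply: (cvg_ext (cvgM ug (cvgV (oner_neq0 _) gg))).
    by apply: nearW => j /=; rewrite invf_div mulrA divfK// lt0r_neq0.
  by rewrite invr1 mulr1.
apply/cvgrPdist_le => e e0.
move/cvgrPdist_le : up => /(_ e e0) [J1 _ h1].
move/cvgrPdist_le : lo => /(_ e e0) [J2 _ h2].
pose J := maxn J1 J2.
exists (n_ J) => // n /= Jn.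
(* The index [j] is the largest with [n_ j <= n]; it exists because [j <= n_ j], and [n_] need not
   be monotone. *)
have [j Jj /andP[jn nj]] : exists2 j, (J <= j)%N & (n_ j <= n < n_ j.+1)%N.
  have ex : exists j, (n_ j <= n)%N by exists J.
  have bd j : (n_ j <= n)%N -> (j <= n)%N by apply: leq_trans.
  case: (ex_maxnP ex bd) => j jn jmax; exists j; first exact: jmax.
  by rewrite jn /= ltnNge; apply/negP => /jmax; rewrite ltnn.
have gn : 0 < g n by apply: g0; exact: leq_trans jn.
have a1 : u n / g n <= u (n_ j.+1) / g (n_ j).
  apply: ler_pM; [exact: u0|by rewrite invr_ge0 ltW|exact/um/ltnW|].
  by rewrite lef_pV2 ?posrE//; exact: gm.
have a2 : u (n_ j) / g (n_ j.+1) <= u n / g n.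
  apply: ler_pM; [exact: u0|by rewrite invr_ge0 ltW|exact/um|].
  by rewrite lef_pV2 ?posrE//; exact/gm/ltnW.
have := h1 j (leq_trans (leq_maxl _ _) Jj).
have := h2 j (leq_trans (leq_maxr _ _) Jj).
rewrite /= !ler_norml => /andP[_ b2] /andP[b1 _].
by apply/andP; split; lra.
Qed.

(** * Harmonic sums against the logarithm *)

Local Notation H := (@harmonic_sum R).

(** Induction on [ln (1 + t) <= t] at [t = 1 / (n + 1)]; the upper bound below uses
    [t = - 1 / (n + 2)]. *)
Lemma ln_le_harmonic_sum n : ln n.+1%:R <= H n.
Proof.
elim: n => [|n IH]; first by rewrite ln1 harmonic_sum_ge0.
rewrite harmonic_sumS.
have n1 : (0 : R) < n.+1%:R by rewrite ltr0n.
have -> : (n.+2%:R : R) = n.+1%:R * (1 + n.+1%:R^-1).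
  by rewrite mulrDr mulr1 divff ?natr1// lt0r_neq0.
have i0 : (0 : R) < n.+1%:R^-1 by rewrite invr_gt0.
rewrite lnM ?posrE ?addr_gt0// lerD//; apply: le_ln1Dx.
by apply: lt_trans i0; rewrite ltrN10.
Qed.

Lemma harmonic_sum_le_ln n : H n <= 1 + ln n%:R.
Proof.
(* At [n = 0] the logarithm takes its default value 0. *)
case: n => [|n]; first by rewrite /H big_ord0 ln0// addr0 ler01.
elim: n => [|n IH]; first by rewrite /H big_ord1 ln1 addr0 invr1.
rewrite harmonic_sumS.
have n1 : (0 : R) < n.+1%:R by rewrite ltr0n.
have n2 : (0 : R) < n.+2%:R by rewrite ltr0n.
have e : (n.+1%:R : R) = n.+2%:R * (1 + - n.+2%:R^-1).
  rewrite mulrDr mulr1 mulrN divff ?lt0r_neq0//.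
  by rewrite -[n.+2%:R]natr1 addrK.
have i1 : -1 < - n.+2%:R^-1 :> R by rewrite ltrN2 invf_lt1// ltr1n.
have := le_ln1Dx i1; move: (n.+2%:R^-1 : R) e i1 => t e i1.
have : ln n.+1%:R = ln n.+2%:R + ln (1 + - t) :> R.
  by rewrite e lnM ?posrE// -ltrBlDl sub0r.
move: IH; lra.
Qed.

End Asymptotics.

(** * The deterministic rate of the sieve *)

Section Rate.
Variable R : realType.

Lemma cvg_affine {T : Type} {F : set_system T} {FF : Filter F} (a b : R)
  (f : T -> R) (l m : R) : f x @[x --> F] --> l -> a + b * l = m ->
  a + b * f x @[x --> F] --> m.
Proof.
move=> fl <-; apply: cvgD; first exact: cvg_cst.
exact: cvgMl_tmp.
Qed.

Lemma sum_inv_sqr_le N : \sum_(j < N) (j.+1%:R ^- 2 : R) <= 2.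
Proof.
(* The sharper bound is inductive, as [(m + 1) ^- 2] is at most [1 / m - 1 / (m + 1)]. *)
suff h n : \sum_(j < n.+1) (j.+1%:R ^- 2 : R) <= 2 - n.+1%:R^-1.
  case: N => [|n]; first by rewrite big_ord0.
  by apply: le_trans (h n) _; rewrite lerBlDr lerDl invr_ge0.
elim: n => [|n IH]; first by rewrite big_ord1 invr1 expr1n invr1; lra.
rewrite big_ord_recr/=.
have n1 : (1 : R) <= n.+1%:R by rewrite ler1n.
move: IH n1; rewrite -[n.+2%:R]natr1; move: (n.+1%:R : R) => m IH m1.
have h : (m + 1) ^- 2 <= m^-1 - (m + 1)^-1.
  have -> : m^-1 - (m + 1)^-1 = m^-1 * (m + 1)^-1.
    by field; apply/andP; split; apply: lt0r_neq0; lra.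
  rewrite -exprVn expr2 ler_wpM2r ?invr_ge0; [by []|lra|].
  by rewrite lef_pV2 ?posrE; lra.
move: IH h; lra.
Qed.

Local Notation H := (@harmonic_sum R).

(** The deterministic counterpart of [keep]: the reciprocal of the mean of [1 / keep] found in
    [keepV_mean]. *)
Definition rate n : R := (1 + H n)^-1.
Definition rate_sum n : R := \sum_(i < n) rate i ^+ 2.

Lemma addr1H_gt0 n : 0 < 1 + H n.
Proof. by rewrite ltr_pwDl// harmonic_sum_ge0. Qed.

Lemma rate_gt0 n : 0 < rate n.
Proof. by rewrite invr_gt0 addr1H_gt0. Qed.

Lemma harmonic_sum_homo : {homo H : m n / (m <= n)%N >-> m <= n}.
Proof.
apply: homo_leq => [//|m n p|n]; first exact: le_trans.
by rewrite harmonic_sumS lerDl invr_ge0.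
Qed.

Lemma rate_homo m n : (m <= n)%N -> rate n <= rate m.
Proof.
by move=> mn; rewrite lef_pV2 ?posrE ?addr1H_gt0// lerD2l harmonic_sum_homo.
Qed.

Lemma harmonic_sum_dvg : H n @[n --> \oo] --> +oo.
Proof.
apply/cvgryPge => A; near=> n.
apply: le_trans (ln_le_harmonic_sum R n).
rewrite -[A]expRK ler_ln ?posrE ?expR_gt0 ?ltr0n//.
apply: (@le_trans _ _ n%:R); last by rewrite ler_nat.
by near: n; exact: nbhs_infty_ger.
Unshelve. all: by end_near. Qed.

Lemma rate_cvg0 : rate n @[n --> \oo] --> 0.
Proof.
apply/(@gtr0_cvgV0 _ _ _ _ (fun n => 1 + H n)).
  by apply: nearW => n; exact: addr1H_gt0.
apply/cvgryPge => A; move/cvgryPge : harmonic_sum_dvg => /(_ A).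
by apply: filterS => n h; apply: le_trans h _; rewrite lerDr.
Qed.

(** Each step adds at most 3 to the square, because [1 + H n <= n + 1]. The bound lets [rate_sum]
    dominate a quarter of the harmonic sum and so diverge. *)
Lemma addr1H_sqr_le n : (1 + H n) ^+ 2 <= 4 * n.+1%:R.
Proof.
elim: n => [|n IH]; first by rewrite /harmonic_sum big_ord0 addr0 expr1n; lra.
rewrite harmonic_sumS.
have h0 := harmonic_sum_ge0 R n; have h1 := harmonic_sum_le R n.
have n1 : (1 : R) <= n.+1%:R by rewrite ler1n.
move: IH h0 h1 n1; rewrite -[n.+2%:R]natr1 -[n.+1%:R]natr1.
move: (H n) (n%:R : R) => h x IH h0 h1 x1.
have i0 : 0 < (x + 1)^-1 by rewrite invr_gt0; lra.
have i1 : (x + 1)^-1 <= 1 by rewrite invf_le1; lra.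
have i2 : (1 + h) * (x + 1)^-1 <= 1 by rewrite ler_pdivrMr; lra.
have i3 : (x + 1)^-1 ^+ 2 <= 1 by rewrite exprn_ile1// ltW.
have -> : (1 + (h + (x + 1)^-1)) ^+ 2 =
  (1 + h) ^+ 2 + 2 * ((1 + h) * (x + 1)^-1) + (x + 1)^-1 ^+ 2.
  by move: ((x + 1)^-1) => t; ring.
move: IH i2 i3; lra.
Qed.

Lemma rate_sum_dvg : rate_sum n @[n --> \oo] --> +oo.
Proof.
apply/cvgryPge => A; move/cvgryPge : harmonic_sum_dvg => /(_ (4 * A)).
apply: filterS => n h.
have : 4^-1 * H n <= rate_sum n.
  rewrite mulr_sumr; apply: ler_sum => i _.
  rewrite -invfM /rate exprVn lef_pV2 ?posrE ?exprn_gt0 ?addr1H_gt0//.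
  exact: addr1H_sqr_le.
by move: h; lra.
Qed.

Lemma rate_sumS n : rate_sum n.+1 = rate_sum n + rate n ^+ 2.
Proof. by rewrite /rate_sum big_ord_recr. Qed.

Lemma rate_sum_homo : {homo rate_sum : m n / (m <= n)%N >-> m <= n}.
Proof.
apply: homo_leq => [//|m n p|n]; first exact: le_trans.
by rewrite rate_sumS lerDl sqr_ge0.
Qed.

Lemma rate_sum_ge n : n%:R * rate n ^+ 2 <= rate_sum n.
Proof.
have -> : n%:R * rate n ^+ 2 = \sum_(i < n) rate n ^+ 2.
  by rewrite sumr_const card_ord mulr_natl.
apply: ler_sum => i _; rewrite ler_pXn2r ?nnegrE ?(ltW (rate_gt0 _))//.
exact/rate_homo/ltnW.
Qed.

Lemma rate_sum_gt0 n : (0 < n)%N -> 0 < rate_sum n.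
Proof.
move=> n0; apply: lt_le_trans (rate_sum_ge n).
by rewrite mulr_gt0 ?ltr0n ?exprn_gt0 ?rate_gt0.
Qed.

(* Summation by parts: [(i + 1) (rate i ^+ 2 - rate i.+1 ^+ 2)] is at most
   [2 rate i ^+ 3], because [rate i - rate i.+1 = rate i * rate i.+1 / (i + 1)]. *)
Lemma rate_sum_le n :
  rate_sum n <= n%:R * rate n ^+ 2 + 2 * \sum_(i < n) rate i ^+ 2 * rate i.
Proof.
elim: n => [|n IH].
  by rewrite /rate_sum !big_ord0 mul0r mulr0 addr0.
rewrite rate_sumS big_ord_recr/=.
have r0 := rate_gt0 n; have r1 := rate_gt0 n.+1; have r2 := rate_homo (leqnSn n).
have n1 : (0 : R) < n.+1%:R by rewrite ltr0n.
have e : n.+1%:R * (rate n - rate n.+1) = rate n * rate n.+1.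
  have hB : n.+1%:R * ((1 + H n.+1) - (1 + H n)) = 1.
    by rewrite harmonic_sumS addrA [X in X - _]addrC addrK divff// lt0r_neq0.
  have := lt0r_neq0 (addr1H_gt0 n); have := lt0r_neq0 (addr1H_gt0 n.+1).
  rewrite /rate; move: hB; move: (1 + H n) (1 + H n.+1) => a B hB B0 a0.
  rewrite -[RHS]mul1r -[X in _ = X * _]hB -mulrA; congr (_ * _).
  by field; rewrite a0 B0.
have {e} : n.+1%:R * (rate n ^+ 2 - rate n.+1 ^+ 2) <= 2 * (rate n ^+ 2 * rate n).
  have -> : n.+1%:R * (rate n ^+ 2 - rate n.+1 ^+ 2) =
      n.+1%:R * (rate n - rate n.+1) * (rate n + rate n.+1) by ring.
  rewrite e; move: r0 r1 r2; move: (rate n) (rate n.+1) => x y x0 y0 yx.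
  have -> : 2 * (x ^+ 2 * x) = x * x * (x + x) by ring.
  by apply: ler_pM; rewrite ?mulr_ge0 ?addr_ge0 ?ler_pM ?lerD2l// ltW.
move: IH; rewrite -[n.+1%:R]natr1 !mulrBr !mulrDl !mul1r; lra.
Qed.

(** The cubic sum in [rate_sum_le] is negligible: divided by [rate_sum] it is a weighted mean of
    [rate], which tends to 0. *)
Lemma rate_sum_equiv : n%:R * rate n ^+ 2 / rate_sum n @[n --> \oo] --> (1 : R).
Proof.
have t := toeplitz (fun i => sqr_ge0 (rate i)) rate_sum_dvg rate_cvg0.
have lo : 1 - 2 * ((\sum_(i < n) rate i ^+ 2 * rate i) / rate_sum n)
    @[n --> \oo] --> (1 : R).
  under eq_fun do rewrite -mulNr.
  by apply: cvg_affine t _; rewrite mulr0 addr0.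
apply: (squeeze_cvgr _ lo (cvg_cst _)); exists 1%N => // n /= n0.
have g0 := rate_sum_gt0 n0.
rewrite ler_pdivrMr// mul1r rate_sum_ge ler_pdivlMr// andbT mulrBl mul1r.
rewrite mulrA divfK ?lt0r_neq0// lerBlDr.
exact: rate_sum_le.
Qed.

(** Every term from time [m] on is at most [rate m ^+ 2], itself at most the average
    [rate_sum m / m] of the earlier ones. *)
Lemma rate_sum_ratio m n : (0 < m)%N -> (m <= n)%N ->
  rate_sum n / rate_sum m <= n%:R / m%:R.
Proof.
move=> m0 mn.
have g0 := rate_sum_gt0 m0; have m0' : (0 : R) < m%:R by rewrite ltr0n.
rewrite ler_pdivrMr// mulrAC ler_pdivlMr//.
suff h d : rate_sum (m + d) <= rate_sum m + d%:R * rate m ^+ 2.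
  have := h (n - m)%N; rewrite subnKC// natrB// => h'.
  have g1 := rate_sum_ge m.
  have d0 : (0 : R) <= n%:R - m%:R by rewrite subr_ge0 ler_nat.
  have := ler_wpM2l d0 g1; have := ler_wpM2l (ltW m0') h'; lra.
elim: d => [|d IH]; first by rewrite addn0 mul0r addr0.
rewrite addnS rate_sumS -natr1.
have : rate (m + d) ^+ 2 <= rate m ^+ 2.
  rewrite ler_pXn2r ?nnegrE ?(ltW (rate_gt0 _))//.
  exact/rate_homo/leq_addr.
move: IH; rewrite mulrDl mul1r; lra.
Qed.

(** * Estimates along the sampling times *)

Lemma cvg_inv_succ : j.+1%:R^-1 @[j --> \oo] --> (0 : R).
Proof. exact: cvg_harmonic. Qed.

Lemma rate_sum_pow_ratio :
  rate_sum (j.+2 ^ 6) / rate_sum (j.+1 ^ 6) @[j --> \oo] --> (1 : R).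
Proof.
have up : (1 + j.+1%:R^-1) ^+ 6 @[j --> \oo] --> (1 : R).
  have h : 1 + 1 * j.+1%:R^-1 @[j --> \oo] --> (1 : R).
    by apply: cvg_affine cvg_inv_succ _; rewrite mulr0 addr0.
  apply: (cvg_ext (cvgM (cvgM h h) (cvgM (cvgM h h) (cvgM h h)))).
    by apply: nearW => j /=; ring.
  by rewrite !mulr1.
apply: (squeeze_cvgr _ (cvg_cst _) up); apply: nearW => j /=.
have p0 : (0 < j.+1 ^ 6)%N by rewrite expn_gt0.
have pp : (j.+1 ^ 6 <= j.+2 ^ 6)%N by rewrite leq_exp2r.
rewrite ler_pdivlMr ?rate_sum_gt0// mul1r rate_sum_homo//=.
apply: le_trans (rate_sum_ratio p0 pp) _.
rewrite !natrX -expr_div_n -[j.+2%:R]natr1 mulrDl mul1r divff//.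
Qed.

Lemma addr1H_pow_le j : 1 + H (j.+1 ^ 6) <= 8 * j.+1%:R.
Proof.
have j1 : (1 : R) <= j.+1%:R by rewrite ler1n.
have h := harmonic_sum_le_ln R (j.+1 ^ 6).
have : ln (j.+1%:R : R) <= j.+1%:R - 1.
  have -> : (j.+1%:R : R) = 1 + (j.+1%:R - 1) by ring.
  rewrite {2}addrC addrK; apply: le_ln1Dx; move: j1; lra.
move: h; rewrite natrX lnXn ?ltr0n// -mulr_natl; move: j1; lra.
Qed.

(* The exponent 6 leaves room for the crude bound [log (j + 1) <= j]: the left
   side is of order [log ^ 4 / (j + 1) ^ 6]. *)
Lemma rate_sum_pow_bound j k :
  (j.+1 ^ 6 + k)%:R / rate_sum (j.+1 ^ 6) ^+ 2 <=
  k.+1%:R * 8 ^+ 4 * j.+1%:R ^- 2.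
Proof.
set n := (j.+1 ^ 6)%N.
have n0 : (0 < n)%N by rewrite expn_gt0.
have n0' : (0 : R) < n%:R by rewrite ltr0n.
have g0 := rate_sum_gt0 n0; have r0 := rate_gt0 n.
have a0 := addr1H_gt0 n.
(* Since [n >= 1], [n + k <= (k + 1) n]; the denominator is bounded below by [rate_sum_ge]. *)
apply: (@le_trans _ _ (k.+1%:R * n%:R / (n%:R * rate n ^+ 2) ^+ 2)).
  apply: ler_pM; rewrite ?invr_ge0 ?sqr_ge0 ?ler0n//.
    by rewrite -natrM ler_nat mulSn leq_add2l leq_pmulr.
  rewrite lef_pV2 ?posrE ?exprn_gt0 ?mulr_gt0 ?exprn_gt0//.
  rewrite ler_pXn2r ?rate_sum_ge ?nnegrE ?ltW//.
  by rewrite mulr_gt0// exprn_gt0.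
rewrite -[leRHS]mulrA -[leLHS]mulrA ler_wpM2l//.
have -> : n%:R / (n%:R * rate n ^+ 2) ^+ 2 = (1 + H n) ^+ 4 / n%:R.
  rewrite /rate; move: (lt0r_neq0 a0) (lt0r_neq0 n0').
  move: (1 + H n) (n%:R : R) => a x a1 x1.
  by field; rewrite a1 x1.

have -> : 8 ^+ 4 * j.+1%:R ^- 2 = (8 * j.+1%:R) ^+ 4 / n%:R :> R.
  have : (j.+1%:R : R) != 0 by rewrite pnatr_eq0.
  rewrite natrX; move: (j.+1%:R : R) => x x0.
  by field; rewrite x0.
rewrite ler_wpM2r ?invr_ge0 ?ler0n//.
by rewrite ler_pXn2r ?nnegrE ?(ltW a0) ?mulr_ge0 ?ler0n//; exact: addr1H_pow_le.
Qed.

Lemma ln2_itv : 2^-1 <= ln (2 : R) <= 1.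
Proof.
(* Both bounds are instances of [ln (1 + t) <= t], at [t = - 1 / 2] and [t = 1]. *)
have h : -1 < (- 2^-1 : R) by lra.
have := le_ln1Dx h.
have -> : 1 + - 2^-1 = 2^-1 :> R by field.
rewrite lnV ?posrE// => h1.
have h2 : -1 < (1 : R) by lra.
by have := le_ln1Dx h2; move: h1; rewrite -[1 + 1]/(2 : R) => h1 ->; rewrite andbT; lra.
Qed.

Lemma addr1H_exp_ge j : j.+1%:R ^+ 2 / 4 <= 1 + H (2 ^ (j ^ 2)).
Proof.
have := ln_le_harmonic_sum R (2 ^ (j ^ 2)).
have : (j%:R : R) ^+ 2 * ln 2 <= ln ((2 ^ (j ^ 2)).+1%:R).
  rewrite -natrX mulr_natl -lnXn// -natrX ler_ln ?posrE ?ltr0n ?expn_gt0//.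
  by rewrite ler_nat.
case/andP: ln2_itv => l1 _.
have := ler_wpM2l (sqr_ge0 (j%:R : R)) l1.
rewrite -[j.+1%:R]natr1; move: (j%:R : R) => x.
have := sqr_ge0 (x - 1); rewrite sqrrB sqrrD.
move: (H _) (ln _) (ln _) => h l l'; lra.
Qed.

(** The increment of [H] is at most [1 + (2 j + 1) ln 2 <= 2 (j + 1)], against a denominator of at
    least [(j + 1) ^ 2 / 4]; hence the error [8 / (j + 1)]. *)
Lemma addr1H_exp_ratio :
  (1 + H (2 ^ (j.+1 ^ 2))) / (1 + H (2 ^ (j ^ 2))) @[j --> \oo] --> (1 : R).
Proof.
have up : 1 + 8 * j.+1%:R^-1 @[j --> \oo] --> (1 : R).
  by apply: cvg_affine cvg_inv_succ _; rewrite mulr0 addr0.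
apply: (squeeze_cvgr _ (cvg_cst _) up); apply: nearW => j /=.
rewrite ler_pdivlMr ?addr1H_gt0// mul1r lerD2l harmonic_sum_homo/=; last first.
  by rewrite leq_pexp2l// leq_exp2r.
rewrite ler_pdivrMr ?addr1H_gt0//.
have h1 := addr1H_exp_ge j.
have h2 := harmonic_sum_le_ln R (2 ^ (j.+1 ^ 2)).
have h3 := ln_le_harmonic_sum R (2 ^ (j ^ 2)).
have h4 : (j%:R : R) ^+ 2 * ln 2 <= ln ((2 ^ (j ^ 2)).+1%:R).
  rewrite -natrX mulr_natl -lnXn// -natrX ler_ln ?posrE ?ltr0n ?expn_gt0//.
  by rewrite ler_nat.
have e5 : ln ((2 ^ (j.+1 ^ 2))%:R : R) = j.+1%:R ^+ 2 * ln 2.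
  by rewrite natrX lnXn// -natrX mulr_natl.
case/andP: ln2_itv => l1 l2.
rewrite e5 in h2.
have j0 : (0 : R) <= j%:R by [].
have j1 : (0 : R) < j.+1%:R by rewrite ltr0n.
have h6 : 8 * j.+1%:R^-1 * (j.+1%:R ^+ 2 / 4) <=
   8 * j.+1%:R^-1 * (1 + H (2 ^ (j ^ 2))).
  by rewrite ler_wpM2l// mulr_ge0// invr_ge0.
have e7 : 8 * j.+1%:R^-1 * (j.+1%:R ^+ 2 / 4) = 2 * j.+1%:R :> R.
  by move: (lt0r_neq0 j1); move: (j.+1%:R : R) => x x0; field.
rewrite e7 in h6; rewrite mulrDl mul1r.
have h8 : (2 * j%:R + 1) * ln 2 <= 2 * (j%:R : R) + 1.
  by rewrite ler_piMr//; move: j0; lra.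
move: h2 h3 h4 h6 h8; rewrite -[j.+1%:R]natr1 sqrrD; lra.
Qed.
End Rate.

(** * From integer to real arguments *)

Section Inversion.
Variable R : realType.

(** Index [i] stands for the integer [i + 2], so the integers from 2 up to [x] are the first
    [(Num.truncn x).-1] indices. *)
Lemma cvg_truncn_pred : (Num.truncn x).-1 @[x --> (+oo : set_system R)] --> \oo.
Proof.
move=> A [N _ NA].
suff : \forall x \near (+oo : set_system R), A (Num.truncn x).-1 by [].
near=> x; apply: NA => /=.
have x0 : 0 <= x by near: x; exact: nbhs_pinfty_ge.
have : (N.+1 <= Num.truncn x)%N.
  by rewrite truncn_ge_nat//; near: x; exact: nbhs_pinfty_ge.
by case: (Num.truncn x).
Unshelve. all: by end_near. Qed.

Lemma ln_cvgy : ln x @[x --> (+oo : set_system R)] --> +oo.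
Proof.
apply/cvgryPge => A; near=> x.
have Ax : expR A <= x by near: x; apply: nbhs_pinfty_ge; exact: num_real.
by rewrite -[A]expRK ler_ln ?posrE ?expR_gt0// (lt_le_trans (expR_gt0 A)).
Unshelve. all: by end_near. Qed.

Lemma inv_ln_cvg0 : (ln x)^-1 @[x --> (+oo : set_system R)] --> (0 : R).
Proof.
apply/(@gtr0_cvgV0 _ _ _ _ (@ln R)); last exact: ln_cvgy.
by near=> x; apply: ln_gt0; near: x; exact: nbhs_pinfty_gt.
Unshelve. all: by end_near. Qed.

Lemma inv_cvg0 : x^-1 @[x --> (+oo : set_system R)] --> (0 : R).
Proof.
apply/(@gtr0_cvgV0 _ _ _ _ (@id R)); last exact: cvg_id.
exact: nbhs_pinfty_gt.
Qed.

Lemma cvg_truncn_div :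
  (Num.truncn x).-1%:R / x @[x --> (+oo : set_system R)] --> (1 : R).
Proof.
have lo : 1 + -2 * x^-1 @[x --> (+oo : set_system R)] --> (1 : R).
  by apply: cvg_affine inv_cvg0 _; rewrite mulr0 addr0.
apply: (squeeze_cvgr _ lo (cvg_cst _)); near=> x.
have x1 : 1 <= x by near: x; exact: nbhs_pinfty_ge.
have x0 : 0 < x by apply: lt_le_trans x1.
have /andP[t1 t2] := truncn_itv (ltW x0).
have t0 : (0 < Num.truncn x)%N by rewrite truncn_gt0.
move: t1 t2; rewrite -(prednK t0) -[X in _ < X]natr1 -natr1 => t1 t2.
rewrite ler_pdivrMr// ler_pdivlMr// mulrDl -mulrA mulVf ?lt0r_neq0//.
by apply/andP; split; lra.
Unshelve. all: by end_near. Qed.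

(** With [m = (Num.truncn x).-1], everything follows from
    [ln x <= 1 + harmonic_sum m <= 2 + ln x]. *)
Lemma cvg_rate_ln :
  rate R (Num.truncn x).-1 * ln x @[x --> (+oo : set_system R)] --> (1 : R).
Proof.
have lo : 1 + -2 * (ln x)^-1 @[x --> (+oo : set_system R)] --> (1 : R).
  by apply: cvg_affine inv_ln_cvg0 _; rewrite mulr0 addr0.
apply: (squeeze_cvgr _ lo (cvg_cst _)); near=> x.
have x2 : 2 <= x by near: x; exact: nbhs_pinfty_ge.
have x0 : 0 < x by apply: lt_le_trans x2.
have l0 : 0 < ln x by apply: ln_gt0; apply: lt_le_trans x2; rewrite ltr1n.
have /andP[t1 t2] := truncn_itv (ltW x0).
have t0 : (2 <= Num.truncn x)%N by rewrite truncn_ge_nat// ltW.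
case: (Num.truncn x) t0 t1 t2 => [//|m] m0 t1 t2 /=.
have m0' : (0 : R) < m%:R by rewrite ltr0n.
have h1 := harmonic_sum_le_ln R m; have h2 := ln_le_harmonic_sum R m.
have a0 := addr1H_gt0 R m.
have h3 : ln (m%:R : R) <= ln x.
  by rewrite ler_ln ?posrE//; apply: le_trans t1; rewrite ler_nat.
(* As [x < m + 2], the quotient [x / (m + 1)] is at most 2, and its logarithm at most 1. *)
have h4 : ln x <= 1 + ln (m.+1%:R : R).
  have -> : ln x = ln (m.+1%:R : R) + ln (1 + (x / m.+1%:R - 1)).
    by rewrite [1 + _]addrC subrK ln_div ?posrE ?ltr0n//; ring.
  have m1 : (1 : R) <= m.+1%:R by rewrite ler1n.
  have x1 : x / m.+1%:R - 1 <= 1.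
    rewrite lerBlDr ler_pdivrMr ?ltr0n//; move: t2 m1.
    by rewrite -[m.+2%:R]natr1; lra.
  have x3 : -1 < x / m.+1%:R - 1 by rewrite ltrBDr addNr divr_gt0// ltr0n.
  by rewrite addrC lerD2r (le_trans (le_ln1Dx x3)).
rewrite /rate [(1 + _)^-1 * _]mulrC ler_pdivrMr// ler_pdivlMr// mul1r.
apply/andP; split; last by move: h2 h4; lra.
have : -2 * (ln x)^-1 * (1 + harmonic_sum R m) <= -2.
  rewrite -mulrA -{2}[-2]mulr1 ler_nM2l ?ltrN10// mulrC ler_pdivlMr// mul1r.
  by move: h2 h4; lra.
rewrite mulrDl mul1r; move: h1 h3; lra.
Unshelve. all: by end_near. Qed.

Lemma cvg_truncn_log (F : nat -> R) :
  F n / (n%:R * rate R n ^+ 2) @[n --> \oo] --> (1 : R) ->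
  F (Num.truncn x).-1 / (x / ln x ^+ 2) @[x --> (+oo : set_system R)]
    --> (1 : R).
Proof.
move=> Fl.
(* With [m = (Num.truncn x).-1], the quotient factors as [F m / (m * rate m ^+ 2)] times [m / x]
   times [(rate m * ln x) ^+ 2]. *)
apply: (cvg_ext (cvgM (cvgM (cvg_comp _ _ cvg_truncn_pred Fl) cvg_truncn_div)
  (cvgM cvg_rate_ln cvg_rate_ln))); last by rewrite !mulr1.
near=> x => /=.
have x2 : 2 <= x by near: x; exact: nbhs_pinfty_ge.
have x0 : 0 < x by apply: lt_le_trans x2.
have t0 : (2 <= Num.truncn x)%N by rewrite truncn_ge_nat// ltW.
case: (Num.truncn x) t0 => [//|m] m0 /=.
have m0' : (m%:R : R) != 0 by rewrite pnatr_eq0 -lt0n.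
have l0 : ln x != 0.
  by apply/lt0r_neq0/ln_gt0; apply: lt_le_trans x2; rewrite ltr1n.
have := lt0r_neq0 (rate_gt0 R m); move: (lt0r_neq0 x0).
move: (rate R m) (m%:R : R) m0' => r y y0 x0' r0.
by field; rewrite l0 x0' y0 r0.
Unshelve. all: by end_near. Qed.
End Inversion.

(** * Pairs along a sample path *)

Section Paths.
Variable R : realType.
Implicit Types alpha : incr_seq.

Local Notation q alpha n := (keep R (bits alpha n)).

Definition pairs (k : nat) alpha (n : nat) : R :=
  \sum_(i < n) (bit alpha i && bit alpha (k + i))%:R.

Lemma pair_countE k x alpha :
  (pair_count k x alpha)%:R = pairs k alpha (Num.truncn (x : R)).-1.
Proof.
(* The condition [i + 2 <= x] reads [i < (Num.truncn x).-1]; for [x < 2] both sides are 0. *)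
pose s := [seq i.+2 | i <- iota 0 (Num.truncn x).-1 &
  bit alpha i && bit alpha (k + i)].
have sE : pair_set k x alpha = [set` [fset j in s]%fset].
  apply/seteqP; split => j /=; rewrite inE /=.
    case=> jx aj ajk.
    have j2 : (2 <= j)%N.
      have : sval alpha `<=` [set n | (2 <= n)%N].
        by have := svalP alpha; rewrite inE.
      exact.
    have x0 : 0 <= x by apply: le_trans jx.
    have : (j <= Num.truncn x)%N by rewrite truncn_ge_nat.
    case: j j2 jx aj ajk => [|[|j]]// _ jx aj ajk jt.
    apply/mapP; exists j => //.
    rewrite mem_filter mem_iota /= add0n; apply/andP; split.
      by apply/andP; split; apply/asboolP => //; rewrite addnC -!addSn.
    by case: (Num.truncn x) jt.
  case/mapP => i; rewrite mem_filter mem_iota /= add0n.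
  case/andP => /andP[/asboolP ai /asboolP aik] it ->; split => //.
    have it' : (i.+2 <= Num.truncn x)%N by case: (Num.truncn x) it.
    have x1 : 1 <= x by rewrite -truncn_gt0; exact: leq_trans it'.
    by rewrite -truncn_ge_nat// (le_trans _ x1).
  by rewrite addnC !addnS.
rewrite /pair_count sE set_fsetK card_fseq undup_id; last first.
  rewrite map_inj_uniq ?filter_uniq ?iota_uniq// => a b []//.
rewrite size_map size_filter /pairs -sum1_count big_mkcond/= natr_sum.
rewrite -{1}[(Num.truncn x).-1]subn0 -/(index_iota 0 _) big_mkord.
by apply: eq_bigr => i _; case: (_ && _).
Qed.

Lemma mart_bits h alpha n : mart h (bits alpha n) =
  \sum_(m < n) h (bits alpha m) * ((bit alpha m)%:R - q alpha m).
Proof.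
by elim: n => [|n IH]; rewrite ?big_ord0// big_ord_recr -IH.
Qed.

Lemma nth_bits alpha m j :
  nth false (bits alpha m) j = (j < m)%N && bit alpha (m - j.+1).
Proof.
elim: m j => [|m IH] [|j]//=; first by rewrite subSS subn0.
Qed.

(* The decision taken [k] steps before the next one, or 0 before time [k]. *)
Definition lag k (b : seq bool) : R := (nth false b k.-1)%:R.

(** At time [k + i] the decision [bit alpha i] is already known, so it is a legitimate weight; the
    first [k] weights vanish by the default value of [nth]. *)
Lemma mart_lag k alpha n : (1 <= k)%N -> mart (lag k) (bits alpha (k + n)) =
  \sum_(i < n) (bit alpha i)%:R * ((bit alpha (k + i))%:R - q alpha (k + i)).
Proof.
move=> k1; rewrite mart_bits big_split_ord /= big1 ?add0r; last first.
  by move=> i _; rewrite /lag nth_bits prednK// leqNgt ltn_ord mul0r.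
by apply: eq_bigr => i _; rewrite /lag nth_bits prednK// addKn leq_addr.
Qed.

Lemma keep_bits_homo alpha m n : (m <= n)%N -> q alpha n <= q alpha m.
Proof.
move=> mn; rewrite -(subnK mn); elim: (n - m)%N => [//|d IH].
rewrite addSn; exact: le_trans (keep_cons_le _ _ _) IH.
Qed.

Definition drift k alpha n : R :=
  \sum_(i < n) (bit alpha i)%:R * (q alpha i - q alpha (k + i)).

(** Dropping the bits leaves [k] telescoping sums, one per unit of lag, each at most 1 because
    [keep] lies in []0, 1]]. *)
Lemma drift_itv k alpha n : 0 <= drift k alpha n <= k%:R.
Proof.
apply/andP; split.
  apply: sumr_ge0 => i _; rewrite mulr_ge0 ?ler0n// subr_ge0.
  exact/keep_bits_homo/leq_addl.
apply: (@le_trans _ _ (\sum_(i < n) (q alpha i - q alpha (k + i)))).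
  apply: ler_sum => i _; case: (bit _ _); rewrite ?mul1r// mul0r subr_ge0.
  exact/keep_bits_homo/leq_addl.
elim: k => [|k IH].
  by rewrite big1// => i _; rewrite add0n subrr.
have e : \sum_(i < n) (q alpha (k + i) - q alpha (k.+1 + i)) <= 1.
  have -> : \sum_(i < n) (q alpha (k + i) - q alpha (k.+1 + i)) =
      q alpha k - q alpha (k + n).
    rewrite -(big_mkord xpredT (fun i => q alpha (k + i) - q alpha (k.+1 + i))).
    under eq_bigr do rewrite addSnnS -opprB.
    by rewrite sumrN (telescope_sumr (fun i => q alpha (k + i)))// opprB addn0.
  by rewrite lerBlDr (le_trans (keep_le1 _ _))// lerDl ltW// keep_gt0.
rewrite -natr1; apply: le_trans (lerD IH e).
by rewrite !sumrB addrA subrK.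
Qed.

Lemma pairs_decomp k alpha n : (1 <= k)%N -> pairs k alpha n =
  mart (lag k) (bits alpha (k + n)) + mart (@keep R) (bits alpha n) +
  \sum_(i < n) q alpha i ^+ 2 - drift k alpha n.
Proof.
move=> k1; rewrite mart_lag// mart_bits /drift /pairs.
rewrite -!big_split -sumrB; apply: eq_bigr => i _ /=.
have -> : (bit alpha i && bit alpha (k + i))%:R =
    (bit alpha i)%:R * (bit alpha (k + i))%:R :> R.
  by rewrite -natrM mulnb.
ring.
Qed.

Lemma pairs_ge0 k alpha n : 0 <= pairs k alpha n.
Proof. by apply: sumr_ge0 => i _; rewrite ler0n. Qed.

Lemma pairs_homo k alpha : {homo pairs k alpha : m n / (m <= n)%N >-> m <= n}.
Proof.
apply: homo_leq => [//|m n p|n]; first exact: le_trans.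
by rewrite /pairs big_ord_recr lerDl ler0n.
Qed.

(* The times [2 ^ (j ^ 2)] make the Chebyshev bounds [1 / log] summable, while
   [log] still has ratio 1 between consecutive times. *)
Lemma keepV_rate_subseq alpha :
  rate R (2 ^ (j ^ 2)) ^+ 2 * ((q alpha (2 ^ (j ^ 2)))^-1 -
    (1 + harmonic_sum R (2 ^ (j ^ 2)))) ^+ 2 @[j --> \oo] --> (0 : R) ->
  q alpha n / rate R n @[n --> \oo] --> (1 : R).
Proof.
under eq_fun do rewrite -exprMn.
move=> /cvg_sqr0 h.
(* The interpolation is done on reciprocals, which are nondecreasing as [cvg_ratio_subseq]
   requires. *)
have c : (q alpha n)^-1 / (1 + harmonic_sum R n) @[n --> \oo] --> (1 : R).
  apply: (@cvg_ratio_subseq _ _ _ (fun j => 2 ^ (j ^ 2))%N).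
  - by move=> n; rewrite invr_ge0 ltW// keep_gt0.
  - by move=> m n mn; rewrite lef_pV2 ?posrE ?keep_gt0// keep_bits_homo.
  - by move=> n _; exact: addr1H_gt0.
  - by move=> m n mn; rewrite lerD2l harmonic_sum_homo.
  - by move=> j; rewrite expn_gt0.
  - move=> j; apply: (leq_trans (ltnW (ltn_expl j (ltnSn 1)))).
    by rewrite leq_exp2l//; case: j => // j; rewrite expnS leq_pmulr// expn_gt0.
  - exact: addr1H_exp_ratio.
  - have h1 : 1 + 1 * 0 = 1 :> R by rewrite mulr0 addr0.
    apply: (cvg_ext (cvg_affine h h1)) => //.
    apply: nearW => j /=; rewrite mul1r mulrBr /rate mulVf ?subrKC.
      by rewrite mulrC.
    exact/lt0r_neq0/addr1H_gt0.
apply: (cvg_ext (cvgV (oner_neq0 _) c)); last by rewrite invr1.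
by apply: nearW => n /=; rewrite /rate !invfM !invrK.
Qed.

(** The quotient is the mean of [(q / rate) ^+ 2] for the weights [rate ^+ 2], so [toeplitz]
    applies. *)
Lemma sum_sqr_keep alpha : q alpha n / rate R n @[n --> \oo] --> (1 : R) ->
  (\sum_(i < n) q alpha i ^+ 2) / rate_sum R n @[n --> \oo] --> (1 : R).
Proof.
move=> c.
have cc : q alpha n / rate R n * (q alpha n / rate R n) @[n --> \oo]
    --> (1 * 1 : R) by exact: cvgM.
have r0 i : 0 <= rate R i ^+ 2 := sqr_ge0 _.
apply: (cvg_ext (toeplitz r0 (@rate_sum_dvg R) cc)); last by rewrite mulr1.
apply: nearW => n; congr (_ / _); apply: eq_bigr => i _ /=.
have := lt0r_neq0 (rate_gt0 R i); move: (rate R i) (q alpha i) => r p {}r0.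
by field.
Qed.

(** A statement about a single path. The limit is first taken against [rate_sum] along the times
    [(j + 1) ^ 6], extended by monotonicity of [pairs], and renormalised by [rate_sum_equiv]. *)
Lemma pairs_asymp k alpha : (1 <= k)%N ->
  q alpha n / rate R n @[n --> \oo] --> (1 : R) ->
  mart (lag k) (bits alpha (k + j.+1 ^ 6)) / rate_sum R (j.+1 ^ 6)
    @[j --> \oo] --> (0 : R) ->
  mart (@keep R) (bits alpha (j.+1 ^ 6)) / rate_sum R (j.+1 ^ 6)
    @[j --> \oo] --> (0 : R) ->
  pairs k alpha n / (n%:R * rate R n ^+ 2) @[n --> \oo] --> (1 : R).
Proof.
move=> k1 qc m1 m2.
have pow_oo : (j.+1 ^ 6)%N @[j --> \oo] --> \oo.
  move=> A [N _ NA]; exists N => // j /= Nj; apply: NA => /=.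
  by apply: (leq_trans Nj); rewrite expnS (leq_trans (leqnSn j))// leq_pmulr// expn_gt0.
have s := cvg_comp _ _ pow_oo (sum_sqr_keep qc).
have d : drift k alpha (j.+1 ^ 6) / rate_sum R (j.+1 ^ 6) @[j --> \oo] --> (0 : R).
  have iv : 0 + k%:R * (rate_sum R n)^-1 @[n --> \oo] --> (0 : R).
    apply: (@cvg_affine _ _ _ _ _ _ _ 0); last by rewrite mulr0 addr0.
    apply/(@gtr0_cvgV0 _ _ _ _ (rate_sum R)); last exact: rate_sum_dvg.
    by exists 1%N => // n /= n0; exact: rate_sum_gt0.
  apply: (squeeze_cvgr _ (cvg_cst _) (cvg_comp _ _ pow_oo iv)).
  apply: nearW => j /=; rewrite add0r.
  have g0 : 0 < rate_sum R (j.+1 ^ 6) by rewrite rate_sum_gt0 ?expn_gt0.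
  have /andP[d0 d1] := drift_itv k alpha (j.+1 ^ 6).
  by rewrite divr_ge0 ?(ltW g0)//= ler_wpM2r// invr_ge0 ltW.
have g : pairs k alpha n / rate_sum R n @[n --> \oo] --> (1 : R).
  apply: (@cvg_ratio_subseq _ _ _ (fun j => j.+1 ^ 6)%N).
  - exact: pairs_ge0.
  - exact: pairs_homo.
  - by move=> n; exact: rate_sum_gt0.
  - exact: rate_sum_homo.
  - by move=> j; rewrite expn_gt0.
  - by move=> j; rewrite expnS (leq_trans (leqnSn j))// leq_pmulr// expn_gt0.
  - exact: rate_sum_pow_ratio.
  - apply: (cvg_ext (cvgB (cvgD (cvgD m1 m2) s) d)).
      apply: nearW => j; rewrite pairs_decomp// [RHS]mulrBl.
      by rewrite [X in _ = X - _]mulrDl [X in _ = X + _ - _]mulrDl.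
    by rewrite add0r subr0 add0r.
apply: (cvg_ext (cvgM g (cvgV (oner_neq0 _) (@rate_sum_equiv R)))).
  exists 1%N => // n /= n0; rewrite invf_div mulrA divfK//.
  exact/lt0r_neq0/rate_sum_gt0.
by rewrite invr1 mulr1.
Qed.
End Paths.

(** * Almost sure limits and the pair count *)

Section AlmostEverywhere.
Variables (R : realType) (mu : probability sieve_space R).
Hypothesis hmu : is_hawkins_measure mu.

Lemma ae_keep_rate : {ae mu, forall alpha : sieve_space,
  keep R (bits alpha n) / rate R n @[n --> \oo] --> (1 : R)}.
Proof.
pose Z j b := rate R (2 ^ (j ^ 2)) ^+ 2 *
  ((keep R b)^-1 - (1 + harmonic_sum R (size b))) ^+ 2.
have Z0 j b : 0 <= Z j b by rewrite mulr_ge0 ?sqr_ge0.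
(* The normalised variance is at most [rate], which is at most [4 / (j + 1) ^ 2] at these times; the
   inverse squares sum to at most 2. *)
have ZC N : \sum_(j < N) iter (2 ^ (j ^ 2)) (@step R) (Z j) [::] <= 8.
  apply: (@le_trans _ _ (4 * \sum_(j < N) j.+1%:R ^- 2)); last first.
    have := sum_inv_sqr_le R N; lra.
  rewrite mulr_sumr; apply: ler_sum => j _; rewrite iter_stepZ.
  set n := (2 ^ (j ^ 2))%N.
  have r0 := rate_gt0 R n; have a0 := addr1H_gt0 R n.
  apply: (@le_trans _ _ (rate R n)).
    apply: (le_trans (ler_wpM2l (sqr_ge0 _) (keepV_var R n))).
    rewrite expr2 -mulrA ler_piMr ?(ltW r0)// /rate mulrC ler_pdivrMr// mul1r.
    by rewrite lerDr.
  have -> : 4 * j.+1%:R ^- 2 = (j.+1%:R ^+ 2 / 4)^-1 :> R.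
    by rewrite invf_div.
  by rewrite lef_pV2 ?posrE ?addr1H_exp_ge// divr_gt0// exprn_gt0// ltr0n.
have aeF : Filter (almost_everywhere mu) := ae_filter_ringOfSetsType mu.
apply: filterS (ae_cvg0_bits hmu Z0 ZC) => alpha; rewrite /Z => h.
apply: keepV_rate_subseq; apply: (cvg_ext h) => //.
by apply: nearW => j /=; rewrite size_bits.
Qed.

(** The second moment is at most the time [k + (j + 1) ^ 6], so [rate_sum_pow_bound] makes the
    normalised moments summable. *)
Lemma ae_mart_rate_sum h k : (forall b, 0 <= h b <= 1) ->
  {ae mu, forall alpha : sieve_space,
  mart h (bits alpha (k + j.+1 ^ 6)) / rate_sum R (j.+1 ^ 6)
    @[j --> \oo] --> (0 : R)}.
Proof.
move=> h01.
pose Z j b := (rate_sum R (j.+1 ^ 6)) ^- 2 * mart h b ^+ 2.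
have Z0 j b : 0 <= Z j b by rewrite mulr_ge0 ?invr_ge0 ?sqr_ge0.
have ZC N : \sum_(j < N) iter (k + j.+1 ^ 6) (@step R) (Z j) [::] <=
    k.+1%:R * 8 ^+ 4 * 2.
  apply: (@le_trans _ _ (k.+1%:R * 8 ^+ 4 * \sum_(j < N) j.+1%:R ^- 2)).
    rewrite mulr_sumr; apply: ler_sum => j _; rewrite iter_stepZ.
    apply: le_trans (rate_sum_pow_bound R j k).
    rewrite mulrC addnC ler_wpM2r ?invr_ge0 ?sqr_ge0//.
    exact: mart_sqr_le.
  by rewrite ler_wpM2l ?sum_inv_sqr_le// mulr_ge0// exprn_ge0.
have aeF : Filter (almost_everywhere mu) := ae_filter_ringOfSetsType mu.
apply: filterS (ae_cvg0_bits hmu Z0 ZC) => alpha; rewrite /Z => hZ.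
apply: cvg_sqr0; apply: (cvg_ext hZ) => //.
by apply: nearW => j /=; rewrite expr_div_n mulrC.
Qed.
End AlmostEverywhere.

Theorem theorem2 (R : realType) (mu : probability sieve_space R)
    (hmu : is_hawkins_measure mu) (k : nat) (hk : (1 <= k)%N) :
  {ae mu, forall alpha : sieve_space,
    (pair_count k x alpha)%:R / (x / ln x ^+ 2) @[x --> (+oo : set_system R)]
      --> (1 : R)}.
Proof.
have lag01 b : 0 <= lag R k b <= 1.
  by rewrite /lag; case: nth; rewrite ?lexx ?ler01.
have keep01 b : 0 <= keep R b <= 1 by rewrite keep_le1 ltW// keep_gt0.
have aeF : Filter (almost_everywhere mu) := ae_filter_ringOfSetsType mu.
(* The transform by [lag] is sampled [k] steps later than the one by [keep], as in
   [pairs_decomp]. *)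
apply: filterS3 (ae_keep_rate hmu) (ae_mart_rate_sum hmu k lag01)
  (ae_mart_rate_sum hmu 0 keep01) => alpha qc m1 m2.
apply: (cvg_ext (cvg_truncn_log (pairs_asymp hk qc m1 m2))) => //.
by apply: nearW => x /=; rewrite pair_countE.
Qed.
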